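(* Let $p_\theta$ be the density of $N(\theta,1)$, $\theta\in\mathbb{R}$, and for data points $x_1,\ldots,x_n\in\mathbb{R}$ let $\hat\pi_{\mathrm{NPMLE}}$ be the nonparametric maximum likelihood estimator of the mixing distribution over all probability measures on $\mathbb{R}$. Let $x_{\min}=\min_{1\le i\le n}x_i$ and $x_{\max}=\max_{1\le i\le n}x_i$. (i) There exists a universal constant $C_0$ such that $$|\mathrm{supp}(\hat\pi_{\mathrm{NPMLE}})|\le C_0\,(x_{\max}-x_{\min})^2.$$ (ii) Consequently, suppose $x_1,\ldots,x_n$ are drawn independently from $\pi*N(0,1)$ for some $s$-subgaussian mixing distribution $\pi$, i.e. $\int \pi(d\theta)\,e^{t\theta}\le e^{st^2/2}$ for all $t\in\mathbb{R}$. Then for any $\tau>0$ there exists some constant $C=C(s,\tau)$ such that with probability at least $1-n^{-\tau}$, $$|\mathrm{supp}(\hat\pi_{\mathrm{NPMLE}})|\le C\log n.$$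
   Context: For a probability measure $\pi$ on $\mathbb{R}$, the mixture density is $p_\pi(x)=\int_{\mathbb{R}} p_\theta(x)\,\pi(d\theta)$; here $p_\theta(x)=\frac{1}{\sqrt{2\pi}}e^{-(x-\theta)^2/2}$ (with $\pi=3.14\ldots$ in the constant), so $p_\pi$ is the density of $\pi*N(0,1)$. Given $x_1,\dots,x_n\in\mathbb{R}$, the nonparametric maximum likelihood estimator (NPMLE) $\hat\pi_{\mathrm{NPMLE}}$ is a maximizer of $\pi\mapsto\frac1n\sum_{i=1}^n\log p_\pi(x_i)$ over all probability measures $\pi$ on $\mathbb{R}$ (in this model the maximizer exists, is unique and is a discrete distribution). $|\mathrm{supp}(\cdot)|$ denotes the number of atoms (mass points).
   Formalization: In (i) the bound is max(1, C_0 (x_max − x_min)^2) instead of C_0 (x_max − x_min)^2, since the original fails when all x_i coincide (the NPMLE is then one point mass, with |supp| = 1 > 0). *)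

(* Defs.v *)
From HB Require Import structures.
From mathcomp Require Import all_boot all_order all_algebra.
From mathcomp Require Import all_classical all_reals all_analysis.

Set Implicit Arguments.
Unset Strict Implicit.
Unset Printing Implicit Defensive.

Import Order.TTheory GRing.Theory Num.Theory.
Import numFieldNormedType.Exports.

Local Open Scope classical_set_scope.
Local Open Scope ring_scope.

Section npmle.
Context {R : realType}.
Implicit Types mu nu : probability (measurableTypeR R) R.

(* The integrand takes values in ]0, (2 pi)^(-1/2)], so the real-valued
   integral is the true one and is positive. *)
Definition mixture_density mu (x : R) : R :=
  \int[mu]_theta normal_pdf theta 1 x.

Definition log_likelihood (n : nat) (x : 'I_n -> R) mu : R :=
  n%:R^-1 * \sum_(i < n) ln (mixture_density mu (x i)).

Definition is_npmle (n : nat) (x : 'I_n -> R) mu : Prop :=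
  forall nu, log_likelihood x nu <= log_likelihood x mu.

Definition atoms mu : set R := [set theta | (0 < mu [set theta])%E].

(* Number of mass points of a discrete distribution. The value is +oo when mu
   is not discrete, so that a finite bound on [supp_card mu] forces mu to be a
   finite mixture of Dirac masses; [counting] of an infinite set is +oo. *)
Definition supp_card mu : \bar R :=
  if `[< mu (atoms mu) = 1%E >] then counting (atoms mu) else +oo%E.

(* Samples are indexed by 'I_n.+1 so that minimum and maximum make sense; the
   value at ord0 only serves as the initial value of the iteration. *)
Definition sample_min (n : nat) (x : 'I_n.+1 -> R) : R :=
  \big[Num.min/x ord0]_(i < n.+1) x i.

Definition sample_max (n : nat) (x : 'I_n.+1 -> R) : R :=
  \big[Num.max/x ord0]_(i < n.+1) x i.

(* s is the variance proxy, not its square root. *)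
Definition subgaussian (s : R) mu : Prop :=
  forall t : R,
    (\int[mu]_theta (expR (t * theta))%:E <= (expR (s * t ^+ 2 / 2))%:E)%E.

(* The convolution mu * N(0,1): law of theta + z under mu \x N(0,1). *)
Definition conv_normal mu : set R -> \bar R :=
  pushforward (mu \x normal_prob (0 : R) 1)%E
    (fun p : measurableTypeR R * measurableTypeR R => p.1 + p.2).

(* Taking some of the A i to be setT yields the product rule for
   subfamilies. *)
Definition mutually_independent d (T : measurableType d) (P : probability T R)
    (n : nat) (X : 'I_n -> {RV P >-> R}) : Prop :=
  forall A : 'I_n -> set R, (forall i, measurable (A i)) ->
    P (\bigcap_(i in [set: 'I_n]) (X i @^-1` A i)) =
    (\prod_(i < n) P (X i @^-1` A i))%E.

Definition iid_from d (T : measurableType d) (P : probability T R)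
    (n : nat) (X : 'I_n -> {RV P >-> R}) (law : set R -> \bar R) : Prop :=
  mutually_independent X /\
  forall (i : 'I_n) (A : set R), measurable A -> distribution P (X i) A = law A.

End npmle.

(* Main.v *)
Require Import Defs.
From HB Require Import structures.
From mathcomp Require Import all_boot all_order all_algebra.
From mathcomp Require Import all_classical all_reals all_analysis.
From mathcomp Require Import measurable_realfun ring lra.
Set Implicit Arguments.
Unset Strict Implicit.
Unset Printing Implicit Defensive.

Import Order.TTheory GRing.Theory Num.Theory.
Import numFieldNormedType.Exports.
Local Open Scope classical_set_scope.
Local Open Scope ring_scope.

(* Moving a little mass of the NPMLE to a point t and differentiating the log
   likelihood shows that D(t) = n^-1 sum_i p_t(x_i) / p_mu(x_i) is at most 1;
   since D integrates to 1 under mu, mu is carried by the maximizers of D. These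
   are zeros of D', which up to a positive factor and a translation to the
   midpoint of the sample is G(z) = sum_i c_i (y_i - z) exp(y_i z), with c_i > 0
   and all |y_i| <= r, where r is half the range. Zeros of G lie in [-r, r], and
   N of them force, by the interpolation error formula
     N! G(z0) = G^(N)(xi) prod_j (z0 - z_j)
   at z0 = -2r, where G is not small, the inequality N! <= (C r^2)^N e^(4 r^2) N,
   hence N = O(r^2). For small r, G' < 0 and there is only one zero.
   The second part follows from the union bound and Chernoff bounds for the
   mixing distribution and for the Gaussian noise. *)

(** * Rolle's theorem, the interpolation error and the number of zeros of G *)

Section zero_counting.
Context {R : realType}.
Implicit Types (f : nat -> R -> R) (s : seq R).

(** One Rolle point is taken in each gap; it lies strictly below the next zero, so the order
    propagates along [path]. *)
Lemma rolle_path (f g : R -> R) (b x : R) s :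
  (forall t, is_derive t (1:R) f (g t)) ->
  path <%R x s -> all (fun t => t <= b) s -> all (fun t => f t == 0) (x :: s) ->
  exists t, [/\ size t = size s, path <%R x t, all (fun u => u <= b) t &
                all (fun u => g u == 0) t].
Proof.
move=> dfg; elim: s x => [|y s IH] x /=; first by exists [::].
move=> /andP[xy ys] /andP[yb sb] /and3P[/eqP fx fy fs].
have [|t [ts yt tb gt]] := IH y ys sb; first by rewrite /= fy.
have df u : derivable f u 1 by have [] := dfg u.
have cf : continuous f.
  by move=> u; apply/differentiable_continuous/derivable1_diffP/df.
have [|||c cxy cf0] := @Rolle R f x y xy.
- by move=> u _; exact: df.
- by apply: continuous_subspaceT => u; exact: cf.
- by rewrite fx (eqP fy).
move: cxy; rewrite in_itv /= => /andP[xc cy].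
exists (c :: t); split => /=; first by rewrite ts.
- by rewrite xc (path_le lt_trans cy yt).
- by rewrite tb (ltW (lt_le_trans cy yb)).
- rewrite gt andbT; apply/eqP.
  have e1 := @derive_val _ _ _ _ _ _ _ (dfg c).
  have e2 := @derive_val _ _ _ _ _ _ _ cf0.
  by rewrite -e1 e2.
Qed.

(** [f k] stands for the k-th derivative of [f 0]. Each pass of [rolle_path] costs one zero, so m +
    1 zeros leave one for the m-th derivative. *)
Lemma iterated_rolle f (a b : R) s :
  (forall k t, is_derive t (1:R) (f k) (f k.+1 t)) ->
  s != [::] -> sorted <%R s -> all (fun t => a <= t <= b) s ->
  all (fun t => f 0 t == 0) s ->
  exists2 c, a <= c <= b & f (size s).-1 c = 0.
Proof.
case: s => // x s df _ /=; move: {2}(size s) (erefl (size s)) => m.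
elim: m s f x df => [|m IH] [|y s] f x df //=.
  by rewrite !andbT => _ _ xab /eqP fx; exists x.
move=> -[sm] /andP[xy ys] /and3P[xab yab sab] fz.
have b_s : all (fun t => t <= b) (y :: s).
  have H : all (fun t => a <= t <= b) (y :: s) by rewrite /= yab.
  by apply/allP => t /(allP H)/andP[].
have [|t [ts xt tb gt]] := rolle_path (df 0%N) _ b_s fz; first by rewrite /= xy.
case: t ts xt tb gt => [//|c t] /= [ts] /andP[xc ct] /andP[cb tb] gt.
rewrite -ts; apply: (IH t (fun k => f k.+1) c) => //.
- by rewrite ts.
- move: xab => /andP[ax _]; rewrite (le_trans ax (ltW xc)) cb /=.
  apply/allP => u ut; rewrite (allP tb _ ut) andbT.
  have /allP/(_ u ut) cu := order_path_min lt_trans ct.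
  by rewrite (le_trans ax) // (le_trans (ltW xc)) // ltW.
Qed.

Lemma prod_XsubC_derivn (s : seq R) :
  (\prod_(z <- s) ('X - z%:P))^`(size s) = ((size s)`!%:R)%:P.
Proof.
set p := \prod_(z <- s) _.
have sp : size p = (size s).+1 by rewrite size_prod_XsubC.
apply/polyP => i; rewrite coef_derivn coefC.
case: i => [|i] /=.
  have : p \is monic by apply: monic_prod => ? _; exact: monicXsubC.
  by move=> /monicP; rewrite /lead_coef sp /= addn0 => ->; rewrite ffactnn.
by rewrite nth_default ?mul0rn// sp addnS ltnS leq_addr.
Qed.

(** For z outside [s], the function f p(z) - f(z) p, with p the monic polynomial of roots [s],
    vanishes on [s] and at z. Iterated Rolle gives a zero of its N-th derivative, in which p
    contributes N!. *)
Lemma interpolation_error f (a b z : R) s :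
  (forall k t, is_derive t (1:R) (f k) (f k.+1 t)) ->
  uniq s -> all (fun t => a <= t <= b) s -> all (fun t => f 0%N t == 0) s ->
  a <= z <= b ->
  exists2 c, a <= c <= b &
    (size s)`!%:R * f 0%N z = f (size s) c * \prod_(t <- s) (z - t).
Proof.
move=> df us sab fs zab.
have [zs|zs] := boolP (z \in s).
  exists z => //; have /eqP -> := allP fs _ zs.
  rewrite mulr0 (perm_big _ (perm_to_rem zs)) /= big_cons subrr mul0r mulr0//.
pose p : {poly R} := \prod_(t <- s) ('X - t%:P).
have pE t : p.[t] = \prod_(u <- s) (t - u).
  by rewrite /p horner_prod; apply: eq_bigr => u _; rewrite !hornerE.
pose g k t := f k t * p.[z] - f 0%N z * (p^`(k)).[t].
have dg k t : is_derive t (1:R) (g k) (g k.+1 t).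
  rewrite /g derivnS.
  have := is_derive_poly (p^`(k)) t; have := df k t => h1 h2.
  by apply: is_derive_eq; rewrite /GRing.scale /=; ring.
have [||||c cab] := @iterated_rolle g a b (sort <=%O (z :: s)) dg.
- by rewrite -size_eq0 size_sort.
- by rewrite sort_lt_sorted /= zs us.
- by rewrite all_sort /= zab sab.
- rewrite all_sort /= /g derivn0 mulrC subrr eqxx /=.
  apply/allP => t ts; rewrite (eqP (allP fs _ ts)) mul0r sub0r oppr_eq0 pE.
  by rewrite (perm_big _ (perm_to_rem ts)) /= big_cons subrr mul0r mulr0.
rewrite size_sort /= /g prod_XsubC_derivn hornerC pE => /eqP.
by rewrite subr_eq0 => /eqP h; exists c => //; rewrite h mulrC.
Qed.

Lemma sum_ord_gt0 n (F : 'I_n -> R) :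
  (0 < n)%N -> (forall i, 0 < F i) -> 0 < \sum_(i < n) F i.
Proof.
case: n F => // n F _ F0; rewrite big_ord_recl ltr_pwDl//.
by apply: sumr_ge0 => i _; exact: ltW.
Qed.

(** * The function G, its derivatives and their size *)

Section tilted_sum.
Variables (n : nat) (c y : 'I_n -> R).

(** Closed form of the k-th derivative of G. At k = 0 the exponent [k.-1] is harmless because the
    factor [k%:R] vanishes. *)
Definition tilted_sum (k : nat) (z : R) : R :=
  \sum_(i < n) c i * (((y i - z) * y i ^+ k - k%:R * y i ^+ k.-1) *
                      expR (y i * z)).

Lemma is_derive_tilted_sum k (z : R) :
  is_derive z (1:R) (tilted_sum k) (tilted_sum k.+1 z).
Proof.
pose h i (u : R) := c i * (((y i - u) * y i ^+ k - k%:R * y i ^+ k.-1) *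
                      expR (y i * u)).
have -> : tilted_sum k = \sum_(i < n) h i.
  by apply/funext => u; rewrite fct_sumE.
apply: is_derive_sum => i.
rewrite /h; apply: is_derive_eq.
rewrite /GRing.scale /=.
case: k {h} => [|k]; rewrite /= ?exprS -?natr1; ring.
Qed.

Variable r : R.
Hypotheses (c0 : forall i, 0 < c i) (yr : forall i, `|y i| <= r).

Lemma tilted_sum_le k (z : R) : 0 <= r -> `|z| <= 2 * r ->
  `|tilted_sum k z| <=
  (\sum_(i < n) c i) * ((3 * r ^+ k.+1 + k%:R * r ^+ k.-1) * expR (2 * r ^+ 2)).
Proof.
move=> r0 zr; rewrite mulr_suml; apply: le_trans (ler_norm_sum _ _ _) _.
apply: ler_sum => i _; rewrite normrM gtr0_norm// ler_pM2l// normrM.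
apply: ler_pM => //.
- rewrite (le_trans (ler_normB _ _))// !normrM !normrX lerD//.
    rewrite exprS mulrA ler_pM//; last by rewrite lerXn2r// nnegrE.
    by rewrite (le_trans (ler_normB _ _))//; have := yr i; lra.
  by rewrite normr_nat ler_wpM2l// lerXn2r// nnegrE.
- rewrite ger0_norm ?expR_ge0// ler_expR (le_trans (ler_norm _))// normrM.
  by rewrite expr2 mulrCA ler_pM.
Qed.

(** At z = -2r nothing cancels: every y_i - z is at least r and every exponent y_i z is at least
    -2r^2. *)
Lemma tilted_sum_ge : 0 <= r ->
  (\sum_(i < n) c i) * (r * expR (- 2 * r ^+ 2)) <= tilted_sum 0 (- 2 * r).
Proof.
move=> r0; rewrite mulr_suml; apply: ler_sum => i _; rewrite ler_pM2l//.
have := yr i; rewrite ler_norml => /andP[yl yu].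
apply: ler_pM => //; rewrite ?expR_ge0//.
- by rewrite expr0 mulr1 mul0r; lra.
- by rewrite ler_expR; nra.
Qed.

(** Interpolation error at -2r, bounded by [tilted_sum_ge] on the left and by [tilted_sum_le] and
    |-2r - t| <= 3r on the right. The total weight occurs on both sides and cancels. *)
Lemma tilted_sum_zeros_fact (s : seq R) : (0 < n)%N -> 0 < r ->
  uniq s -> all (fun t => - r <= t <= r) s ->
  all (fun t => tilted_sum 0 t == 0) s ->
  (size s)`!%:R * (r * expR (- 2 * r ^+ 2)) <=
  (3 * r ^+ (size s).+1 + (size s)%:R * r ^+ (size s).-1) *
    expR (2 * r ^+ 2) * (3 * r) ^+ size s.
Proof.
move=> n0 r0 us sr fs.
have [||d dr] := @interpolation_error tilted_sum (- 2 * r) (2 * r) (- 2 * r) s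
    is_derive_tilted_sum us _ fs.
- by apply/allP => t /(allP sr)/andP[? ?]; apply/andP; split; lra.
- by apply/andP; split; lra.
have A0 : 0 < \sum_(i < n) c i by exact: sum_ord_gt0.
have d2 : `|d| <= 2 * r by rewrite ler_norml; move: dr => /andP[? ?]; lra.
have up := tilted_sum_le (size s) (ltW r0) d2.
have lo := tilted_sum_ge (ltW r0).
have pr : `|\prod_(t <- s) (- 2 * r - t)| <= (3 * r) ^+ size s.
  rewrite normr_prod.
  have -> : (3 * r) ^+ size s = \prod_(t <- s) (3 * r).
    by rewrite big_const_seq count_predT -Monoid.iteropE.
  rewrite big_seq [leRHS]big_seq; apply: ler_prod => t ts; rewrite normr_ge0 /=.
  by have /andP[? ?] := allP sr _ ts; rewrite ler_norml; lra.
move=> e.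
rewrite -(ler_pM2l A0) mulrCA.
apply: (@le_trans _ _ ((size s)`!%:R * tilted_sum 0 (- 2 * r))).
  by rewrite ler_wpM2l.
rewrite e (le_trans (ler_norm _))// normrM [leRHS]mulrA.
by apply: ler_pM.
Qed.

(** Two zeros would give a zero of G' in [-r, r], but each term of G' has the sign of (y_i - z) y_i
    - 1, which is negative since (y_i - z) y_i <= 2r^2 < 1. *)
Lemma tilted_sum_zeros_le1 (s : seq R) : (0 < n)%N -> 2 * r ^+ 2 < 1 ->
  uniq s -> all (fun t => - r <= t <= r) s ->
  all (fun t => tilted_sum 0 t == 0) s -> (size s <= 1)%N.
Proof.
move=> n0 r1; case: s => [//|x [//|x' s]] us sr fs; exfalso.
have us' : uniq [:: x; x'].
  by move: us => /=; rewrite !inE negb_or andbT => /andP[/andP[]].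
have sr' : all (fun t => - r <= t <= r) [:: x; x'].
  by move: sr => /= /and3P[-> -> _].
have fs' : all (fun t => tilted_sum 0 t == 0) [:: x; x'].
  by move: fs => /= /and3P[-> -> _].
have [||||d /andP[dl du]] := @iterated_rolle tilted_sum (- r) r
    (sort <=%O [:: x; x']) is_derive_tilted_sum.
- by rewrite -size_eq0 size_sort.
- by rewrite sort_lt_sorted.
- by rewrite all_sort.
- by rewrite all_sort.
rewrite size_sort /= => /eqP; apply/negP; rewrite lt_eqF// -oppr_gt0 -sumrN.
apply: sum_ord_gt0 => // i; rewrite oppr_gt0 pmulr_rlt0// pmulr_llt0 ?expR_gt0//.
by have := yr i; rewrite ler_norml expr1 expr0 => /andP[? ?]; nra.
Qed.
End tilted_sum.

Lemma natr_expn_le_fact (N : nat) : (N%:R : R) ^+ N <= N`!%:R * expR N%:R.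
Proof.
case: N => [|N]; first by rewrite fact0 expr0 mul1r expR0.
have := @expR_ge1Dxn R N.+1%:R N (ler0n _ _) => h.
have f0 : (0 : R) < N.+1`!%:R by rewrite ltr0n fact_gt0.
rewrite mulrC -ler_pdivrMr//; apply: le_trans h; rewrite lerDr//.
Qed.

(** Were N >= 400q, then exp(4q) <= exp(N), and N! exp(N) would be at most exp(2N) (3q)^N 5^N <= (16
    * 3 * 5 q)^N = (240q)^N < N^N, against [natr_expn_le_fact]. *)
Lemma fact_growth_bound (N : nat) (q : R) : (0 < N)%N -> 1 / 2 <= q ->
  N`!%:R <= expR (4 * q) * (3 * q) ^+ N * (3 + 2 * N%:R) -> N%:R < 400 * q.
Proof.
move=> N0 q2 hN; rewrite ltNge; apply/negP => qN.
have q0 : 0 < q by lra.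
(* From exp(-1/2) >= 1/2 follows exp(1/2) <= 2, and 2^4 = 16. *)
have e16 : expR (2 : R) <= 16.
  have h : (2^-1 : R) <= expR (- 2^-1) by have := expR_ge1Dx (- 2^-1 : R); lra.
  have e0 := expR_gt0 (2^-1 : R).
  have -> : (2 : R) = 4%:R * 2^-1 by lra.
  rewrite expRM_natl.
  have -> : (16 : R) = 2 ^+ 4 by rewrite -natrX.
  rewrite lerXn2r ?nnegrE ?expR_ge0//.
  have := expRxMexpNx_1 (2^-1 : R) => e1; nra.
have pow5 : (3 : R) + 2 * N%:R <= 5 ^+ N.
  elim: N N0 {hN qN} => [//|[_ _|m IH _]]; first by rewrite expr1; lra.
  have := IH isT; rewrite [5 ^+ m.+2]exprS -(natr1 m.+1).
  have : (0:R) <= m.+1%:R by []. lra.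
have := natr_expn_le_fact N; apply/negP; rewrite -ltNge.
have [e0 e1] := (expR_gt0 (N%:R : R), expR_gt0 (4 * q)).
have p0 : 0 < (3 * q) ^+ N by rewrite exprn_gt0//; lra.
have : N`!%:R * expR N%:R <= (240 * q) ^+ N.
  have -> : (240 * q) ^+ N = 16 ^+ N * (3 * q) ^+ N * 5 ^+ N.
    by rewrite -!exprMn; congr (_ ^+ _); lra.
  apply: (@le_trans _ _ (expR N%:R * (expR (4 * q) * (3 * q) ^+ N * (3 + 2 * N%:R)))).
    by rewrite mulrC ler_pM2l.
  rewrite !mulrA -expRD; apply: ler_pM => //; first by rewrite mulr_ge0 ?expR_ge0// ltW.
  rewrite ler_pM2r//; apply: (@le_trans _ _ (expR (2 * N%:R))).
    by rewrite ler_expR; lra.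
  by rewrite expRM_natr lerXn2r ?nnegrE ?expR_ge0.
move=> h; apply: (le_lt_trans h).
by rewrite ltrXn2r -?lt0n// ?nnegrE; lra.
Qed.

(** The [1] covers small r, where one zero remains even for r = 0; otherwise 2r^2 >= 1 and
    [fact_growth_bound] applies with q = r^2. *)
Lemma tilted_sum_zeros_le (n : nat) (c y : 'I_n -> R) (r : R) (s : seq R) :
  (0 < n)%N -> 0 <= r -> (forall i, 0 < c i) -> (forall i, `|y i| <= r) ->
  uniq s -> all (fun t => - r <= t <= r) s ->
  all (fun t => tilted_sum c y 0 t == 0) s ->
  (size s)%:R <= Num.max 1 (400 * r ^+ 2).
Proof.
move=> n0 r0 c0 yr us sr fs.
have [r1|r1] := ltP (2 * r ^+ 2) 1.
  rewrite le_max; apply/orP; left; rewrite -[leRHS]/(1%:R) ler_nat.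
  exact: tilted_sum_zeros_le1 yr s n0 r1 us sr fs.
rewrite le_max; apply/orP; right.
have [->|N0] := posnP (size s).
  by apply: mulr_ge0; [exact: ler0n|exact: sqr_ge0].
have r'0 : 0 < r by nra.
apply/ltW/fact_growth_bound => //; first lra.
have := tilted_sum_zeros_fact c0 yr n0 r'0 us sr fs.
move: N0; case: (size s) => // N _ h.
have q0 : 0 < r ^+ 2 by rewrite exprn_gt0.
have -> : expR (4 * r ^+ 2) = expR (2 * r ^+ 2) * expR (2 * r ^+ 2).
  by rewrite -expRD; congr expR; lra.
have -> : (3 * r ^+ 2) ^+ N.+1 = (3 * r) ^+ N.+1 * (r * r ^+ N).
  by rewrite -exprS -exprMn; congr (_ ^+ _); lra.
move: h; rewrite /= mulNr expRN (exprS r N.+1) (exprS r N).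
set e := expR _; set P := (3 * r) ^+ _; set F := _`!%:R; set Q := r ^+ N.
set K := N.+1%:R => h.
have e0 : 0 < e by exact: expR_gt0.
have P0 : 0 < P by rewrite exprn_gt0// mulr_gt0.
have Q0 : 0 < Q by rewrite exprn_gt0.
have K0 : 0 <= K by [].
move: h; rewrite mulrA ler_pdivrMr// => h.
rewrite -(ler_pM2r r'0); apply: (le_trans h).
have -> : (3 * (r * (r * Q)) + K * Q) * e * P * e =
  (e * e * P * Q) * (3 * r ^+ 2 + K) by rewrite expr2; ring.
have -> : e * e * (P * (r * Q)) * (3 + 2 * K) * r =
  (e * e * P * Q) * (3 * r ^+ 2 + 2 * r ^+ 2 * K) by rewrite expr2; ring.
rewrite ler_pM2l ?mulr_gt0//; nra.
Qed.
End zero_counting.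

(** * Maximizers of a positive combination of Gaussian bumps *)

Section gaussian_sum.
Context {R : realType}.
Variables (n : nat) (w x : 'I_n.+1 -> R).
Hypothesis w0 : forall i, 0 < w i.

(** This is D for suitable weights; the NPMLE enters only later, through
    [normal_peak 1 / (n.+1%:R * p i)]. *)
Definition gaussian_sum (t : R) : R :=
  \sum_(i < n.+1) w i * expR (- (x i - t) ^+ 2 / 2).

Lemma sample_min_le (i : 'I_n.+1) : sample_min x <= x i.
Proof. exact: bigmin_le_cond. Qed.

Lemma sample_max_ge (i : 'I_n.+1) : x i <= sample_max x.
Proof. exact: le_bigmax_cond. Qed.

Lemma gaussian_sum_is_derive (t : R) :
  is_derive t (1:R) gaussian_sum
    (\sum_(i < n.+1) w i * ((x i - t) * expR (- (x i - t) ^+ 2 / 2))).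
Proof.
pose h i (u : R) := w i * expR (- (x i - u) ^+ 2 / 2).
have -> : gaussian_sum = \sum_(i < n.+1) h i.
  by apply/funext => u; rewrite fct_sumE.
apply: is_derive_sum => i; rewrite /h; apply: is_derive_eq.
by rewrite /GRing.scale /=; field.
Qed.

(* Factoring [exp (- (t - c)^2 / 2)] out of the derivative leaves a sum to which
   [tilted_sum_zeros_le] applies, where [c] is the midpoint of the sample. *)
Lemma gaussian_sum_argmax_card (M : R) (s : seq R) :
  uniq s -> (forall t, gaussian_sum t <= M) ->
  {in s, forall t, gaussian_sum t = M} ->
  (size s)%:R <= Num.max 1 (100 * (sample_max x - sample_min x) ^+ 2).
Proof.
move=> us ub sM.
set c := (sample_max x + sample_min x) / 2.
set r := (sample_max x - sample_min x) / 2.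
have -> : 100 * (sample_max x - sample_min x) ^+ 2 = 400 * r ^+ 2.
  by rewrite /r; field.
pose y i := x i - c.
pose v i := w i * expR (- (y i) ^+ 2 / 2).
have v0 i : 0 < v i by rewrite mulr_gt0// expR_gt0.
have yr i : `|y i| <= r.
  have := sample_min_le i; have := sample_max_ge i.
  by rewrite ler_norml /y /c /r => ? ?; apply/andP; split; lra.
have r0 : 0 <= r by rewrite (le_trans _ (yr ord0)).
(* A maximizer is a critical point; multiplying the vanishing derivative by exp((t - c)^2 / 2) gives
   G at t - c. *)
have zt t : t \in s -> tilted_sum v y 0 (t - c) = 0.
  move=> ts.
  have := @derive1_at_max R gaussian_sum (t - 1) (t + 1) t.
  have dg u : derivable gaussian_sum u 1 by have [] := gaussian_sum_is_derive u.
  move=> /(_ _ _ _ _) h.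
  have {h} d0 : is_derive t (1:R) gaussian_sum 0.
    apply: h => [|u _||u _].
    - lra.
    - exact: dg.
    - by rewrite in_itv /=; apply/andP; split; lra.
    - by rewrite (sM t ts).
  have e1 := @derive_val _ _ _ _ _ _ _ (gaussian_sum_is_derive t).
  have e2 := @derive_val _ _ _ _ _ _ _ d0.
  have : expR ((t - c) ^+ 2 / 2) * 0 = 0 :> R by rewrite mulr0.
  rewrite -{1}e2 e1 mulr_sumr => <-; apply: eq_bigr => i _.
  rewrite /v /= expr0 mulr1 mul0r subr0 {1}/y opprB addrA subrK.
  have -> : - (x i - t) ^+ 2 / 2 =
      - (t - c) ^+ 2 / 2 + (- y i ^+ 2 / 2 + y i * (t - c)).
    by rewrite /y; field.
  have E1 : expR ((t - c) ^+ 2 / 2) * expR (- (t - c) ^+ 2 / 2) = 1.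
    by rewrite mulNr expRxMexpNx_1.
  by rewrite !expRD -[LHS]mul1r -{1}E1; ring.
(* Outside [-r, r] all factors y_i - t share one strict sign, so the sum cannot vanish. *)
have zr t : tilted_sum v y 0 t = 0 -> - r <= t <= r.
  move=> tz; rewrite 2!leNgt -negb_or; apply/negP => /orP[tr|tr].
    suff : 0 < tilted_sum v y 0 t by rewrite tz ltxx.
    apply: sum_ord_gt0 => // i; rewrite expr0 mulr1 mul0r subr0.
    rewrite !mulr_gt0 ?expR_gt0//.
    by have := yr i; rewrite ler_norml => /andP[? ?]; lra.
  suff : 0 < - tilted_sum v y 0 t by rewrite tz oppr0 ltxx.
  rewrite -sumrN; apply: sum_ord_gt0 => // i; rewrite expr0 mulr1 mul0r subr0.
  rewrite -mulrN -mulNr !mulr_gt0 ?expR_gt0//.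
  by have := yr i; rewrite ler_norml => /andP[? ?]; lra.
rewrite -(size_map (fun t => t - c)); apply: (tilted_sum_zeros_le _ r0 v0 yr) => //.
- by rewrite map_inj_uniq// => t u /addIr.
- by apply/allP => _ /mapP[t ts ->]; apply/zr/zt.
- by apply/allP => _ /mapP[t ts ->]; apply/eqP/zt.
Qed.
End gaussian_sum.

(** * Positivity, integrability and perturbation of mixture densities *)

Section mixture_density.
Context {R : realType}.
Implicit Types (mu : probability (measurableTypeR R) R) (x t : R).

Lemma normal_pdf1E x t :
  normal_pdf t 1 x = normal_peak 1 * expR (- (x - t) ^+ 2 / 2).
Proof. by rewrite normal_pdfE ?oner_neq0// /normal_fun expr1n. Qed.

Lemma normal_pdf1C x t : normal_pdf t 1 x = normal_pdf x 1 t.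
Proof. by rewrite !normal_pdf1E -sqrrN opprB. Qed.

Lemma normal_pdf1_gt0 x t : 0 < normal_pdf t 1 x :> R.
Proof. by rewrite normal_pdf1E mulr_gt0 ?normal_peak_gt0 ?expR_gt0. Qed.

Lemma measurable_normal_pdf_mean x :
  measurable_fun [set: measurableTypeR R]
    (fun t : measurableTypeR R => normal_pdf t 1 x).
Proof.
have -> : (fun t : measurableTypeR R => normal_pdf t 1 x) = normal_pdf x 1.
  by apply/funext => t; rewrite normal_pdf1C.
exact: measurable_normal_pdf.
Qed.

Lemma measurable_normal_pdf_mean_EFin x :
  measurable_fun setT (fun t : measurableTypeR R => (normal_pdf t 1 x)%:E).
Proof. by apply/measurable_EFinP; exact: measurable_normal_pdf_mean. Qed.

Lemma integrable_normal_pdf_mean mu x :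
  mu.-integrable setT (EFin \o (fun t : measurableTypeR R => normal_pdf t 1 x)).
Proof.
apply: measurable_bounded_integrable => //.
- by rewrite ltey_eq fin_num_measure.
- exact: measurable_normal_pdf_mean.
- exists (normal_peak 1); split; first exact: num_real.
  move=> M pM t _; rewrite /= ger0_norm ?normal_pdf_ge0//.
  by rewrite (le_trans _ (ltW pM))// normal_pdf_ub ?oner_neq0.
Qed.

Lemma mixture_densityE mu x :
  (mixture_density mu x)%:E = (\int[mu]_t (normal_pdf t 1 x)%:E)%E.
Proof.
rewrite /mixture_density /Rintegral fineK//.
exact: integrable_fin_num (integrable_normal_pdf_mean mu x).
Qed.

(** A zero integral would make the everywhere positive integrand vanish almost everywhere, although
    [mu] has mass 1. *)
Lemma mixture_density_gt0 mu x : 0 < mixture_density mu x.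
Proof.
rewrite -lte_fin mixture_densityE lt_neqAle integral_ge0 ?andbT; last first.
  by move=> t _; rewrite lee_fin normal_pdf_ge0.
rewrite eq_sym; apply/eqP => int0.
have /ae_eq_integral_abs : (\int[mu]_t `|(normal_pdf t 1 x)%:E| = 0)%E.
  apply: etrans int0; apply: eq_integral => t _.
  by rewrite gee0_abs// lee_fin normal_pdf_ge0.
have mf := measurable_normal_pdf_mean_EFin x.
move=> /(_ measurableT mf) [N [mN N0 sub]].
have : mu setT = 0%E.
  apply: (subset_measure0 _ mN _ N0) => // t _; apply: sub => /=.
  move=> /(_ I) [] e; have := normal_pdf1_gt0 x t.
  by rewrite e ltxx.
by rewrite (@probability_setT _ _ _ mu) => /eqP; rewrite onee_eq0.
Qed.

(** The witness (1 - e) mu + e delta_t is the competitor against which the optimality of the NPMLE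
    is tested. *)
Lemma dirac_mixture (e : R) mu (t : measurableTypeR R) : 0 <= e <= 1 ->
  exists nu : probability (measurableTypeR R) R, forall x,
    mixture_density nu x = (1 - e) * mixture_density mu x + e * normal_pdf t 1 x.
Proof.
move=> /andP[e0 e1]; have e1' : 0 <= 1 - e by rewrite subr_ge0.
pose nu0 : {measure set (measurableTypeR R) -> \bar R} :=
  measure_add (mscale (NngNum e1') mu) (mscale (NngNum e0) \d_t).
have nuT : nu0 setT = 1%E.
  apply: (etrans (measure_addE _ _ _)); rewrite /= /mscale /=.
  rewrite (@probability_setT _ _ _ mu) diracT !mule1.
  by rewrite -EFinD subrK.
pose pP := Measure_isProbability.Build _ _ _ (Measure.sort nu0) nuT.
pose nu : probability (measurableTypeR R) R := HB.pack (Measure.sort nu0) pP.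
exists nu => x; apply/EFin_inj.
have mf := measurable_normal_pdf_mean_EFin x.
have f0 u : (0 <= (normal_pdf u 1 x)%:E)%E by rewrite lee_fin normal_pdf_ge0.
rewrite mixture_densityE.
have -> : (\int[nu]_u (normal_pdf u 1 x)%:E)%E =
    (\int[nu0]_u (normal_pdf u 1 x)%:E)%E by apply: eq_measure_integral.
rewrite /nu0 ge0_integral_measure_add//.
rewrite !ge0_integral_mscale// integral_dirac// diracT mul1e.
by rewrite /= -mixture_densityE -!EFinM -EFinD.
Qed.

End mixture_density.

(** * Optimality of the NPMLE and its support *)

Section npmle_support.
Context {R : realType}.
Implicit Types mu : probability (measurableTypeR R) R.

Lemma measurable_finite_set (A : set R) :
  finite_set A -> measurable (A : set (measurableTypeR R)).
Proof.
move=> finA; rewrite -[A]image_id -(bigcup_imset1 A id).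
by apply: fin_bigcup_measurable => // t _; exact: measurable_set1.
Qed.

(** The bound on lists makes [S] finite. Atoms lie in [S] because its complement is null, and the
    non-atoms in [S] are finitely many null points; so the atoms carry all the mass and [supp_card]
    takes its finite branch. *)
Lemma supp_card_le mu (S : set R) (K : R) :
  mu.-negligible (~` S) ->
  (forall s : seq R, uniq s -> {in s, forall t, S t} -> (size s)%:R <= K) ->
  (supp_card mu <= K%:E)%E.
Proof.
move=> negS cardS.
have K0 : 0 <= K := cardS [::] isT (fun t => False_ind _ \o notF).
have finS : finite_set S.
  apply: contrapT => /(infinite_set_fset (Num.bound K))[B BS sB].
  have := cardS (finmap.enum_fset B) (finmap.fset_uniq B) (fun t tB => BS t tB).
  apply/negP; rewrite -ltNge (lt_le_trans (archi_boundP K0))// ler_nat//.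
have atomsS : atoms mu `<=` S.
  move=> t /= mut; apply: contrapT => St.
  suff mut0 : mu [set t] = 0%E by move: mut; rewrite /atoms /= mut0 ltxx.
  apply: measure_negligible; first exact: measurable_set1.
  by apply: negligibleS negS => _ ->.
have fin_atoms : finite_set (atoms mu) := sub_finite_set atomsS finS.
have mu_atoms : mu (atoms mu) = 1%E.
  have mD : measurable (S `\` atoms mu : set (measurableTypeR R)).
    by apply: measurable_finite_set; exact: finite_setD.
  have mA : measurable (atoms mu : set (measurableTypeR R)).
    exact: measurable_finite_set.
  have muD : mu (S `\` atoms mu) = 0%E.
    apply/eqP; rewrite eq_le measure_ge0 andbT.
    have := @content_sub_fsum _ _ _ mu R (S `\` atoms mu) _ (fun t => [set t])
      (finite_setD _ finS) (fun t _ => measurable_set1 t) mD.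
    rewrite bigcup_imset1 image_id => /(_ (@subset_refl _ _)) /le_trans; apply.
    rewrite fsbig1// => t [_ /= /negP]; rewrite -leNgt => mut.
    by apply/eqP; rewrite eq_le mut measure_ge0.
  have negA : mu (~` atoms mu) = 0%E.
    apply: measure_negligible; first exact: measurableC.
    have negU : mu.-negligible (~` S `|` (S `\` atoms mu)).
      by apply: negligibleU => //; exists (S `\` atoms mu); split.
    apply: negligibleS negU => t At.
    by have [St|St] := pselect (S t); [right|left].
  have := probability_setC mu (measurableC mA).
  by rewrite setCK negA sube0.
rewrite /supp_card asboolT// /counting asboolT// lee_fin.
apply: cardS; first exact: finmap.fset_uniq.
by move=> t; rewrite in_fset_set// inE => /atomsS.
Qed.

Variables (n : nat) (x : 'I_n.+1 -> R) (mu : probability (measurableTypeR R) R).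
Hypothesis npmle : is_npmle x mu.

Let p i := mixture_density mu (x i).
Let p0 i : 0 < p i. Proof. exact: mixture_density_gt0. Qed.

(** Against (1 - e) mu + e delta_t the likelihood ratios are 1 + e b_i. In place of a limit, ln(1 +
    v) >= v - 2v^2 for v > -1/2 gives B <= 2 e Q for all small e > 0, hence B <= 0. *)
Lemma npmle_gradient_le0 (t : R) :
  \sum_(i < n.+1) (normal_pdf t 1 (x i) / p i - 1) <= 0.
Proof.
set b := fun i : 'I_n.+1 => normal_pdf t 1 (x i) / p i - 1.
rewrite -[leLHS]/(\sum_(i < n.+1) b i); set B := \sum_(i < n.+1) b i.
pose Q := \sum_(i < n.+1) b i ^+ 2.
have Q0 : 0 <= Q by apply: sumr_ge0 => i _; exact: sqr_ge0.
have b1 i : -1 < b i by rewrite /b ltrDr divr_gt0// normal_pdf1_gt0.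
have step e : 0 < e -> e <= 1 / 2 -> B <= 2 * e * Q.
  move=> e0 e1.
  have eb i : 1 / 2 < 1 + e * b i by have := b1 i; nra.
  have [|nu nuE] := @dirac_mixture R e mu t; first by apply/andP; split; lra.
  have lnE i : ln (mixture_density nu (x i)) = ln (p i) + ln (1 + e * b i).
    rewrite -lnM ?posrE//; last by have := eb i; lra.
    congr ln; rewrite nuE /b -/(p i); field; exact: lt0r_neq0.
  have := npmle nu; rewrite /log_likelihood ler_pM2l ?invr_gt0 ?ltr0n//.
  under eq_bigr do rewrite lnE; rewrite big_split /= gerDl => sum_ln.
  rewrite -(ler_pM2l e0) -subr_le0; apply: le_trans sum_ln.
  rewrite mulrCA /B /Q !mulr_sumr -sumrB; apply: ler_sum => i _.
  have ebi := eb i.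
  (* With v = e b_i and u = 1 / (1 + v) < 2: ln(1 + v) >= 1 - u = v - u v^2 >= v - 2v^2. *)
  pose u := (1 + e * b i)^-1.
  have u0 : 0 < u by rewrite invr_gt0; lra.
  have u1 : u * (1 + e * b i) = 1 by rewrite mulVf//; lra.
  have : - ln (1 + e * b i) <= u - 1.
    rewrite -lnV ?posrE -/u; last lra.
    have -> : u = 1 + (u - 1) by lra.
    rewrite -[leRHS]/(1 + (u - 1) - 1) (addrAC 1) subrr add0r.
    by apply: le_ln1Dx; lra.
  have u2 : u < 2 by nra.
  have : 0 <= (2 - u) * (e * b i) ^+ 2 by rewrite mulr_ge0 ?sqr_ge0//; lra.
  have : u * (e * b i) ^+ 2 = e * b i - 1 + u.
    transitivity (u * (1 + e * b i) * (1 + e * b i) - 2 * (u * (1 + e * b i)) + u).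
      by ring.
    by rewrite u1; ring.
  move=> ? ?; nra.
rewrite leNgt; apply/negP => B0.
(* This denominator makes e = B / (2B + 4Q + 4) at most 1/2 and 2 e Q strictly smaller than B,
   contradicting [step]. *)
have d0 : 0 < 2 * B + 4 * Q + 4 by lra.
have := step (B / (2 * B + 4 * Q + 4)) (divr_gt0 B0 d0).
rewrite ler_pdivrMr// => le2.
suff : 2 * (B / (2 * B + 4 * Q + 4)) * Q < B by rewrite ltNge le2//; lra.
have -> : 2 * (B / (2 * B + 4 * Q + 4)) * Q = 2 * B * Q / (2 * B + 4 * Q + 4).
  by field; lra.
rewrite ltr_pdivrMr//; nra.
Qed.


Let w i := normal_peak 1 / (n.+1%:R * p i).
Let w0 i : 0 < w i.
Proof. by rewrite divr_gt0 ?mulr_gt0 ?normal_peak_gt0 ?ltr0n ?oner_neq0. Qed.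

Let gaussian_sumE t :
  gaussian_sum w x t = \sum_(i < n.+1) (n.+1%:R * p i)^-1 * normal_pdf t 1 (x i).
Proof.
rewrite /gaussian_sum; apply: eq_bigr => i _.
by rewrite normal_pdf1E /w [normal_peak 1 / _]mulrC mulrA.
Qed.

Let gaussian_sum_le1 t : gaussian_sum w x t <= 1.
Proof.
rewrite gaussian_sumE; have := npmle_gradient_le0 t.
rewrite sumrB sumr_const card_ord -[1 *+ _]/(n.+1%:R) subr_le0 => h.
have n0 : 0 < n.+1%:R :> R by rewrite ltr0n.
rewrite -(ler_pM2l n0) mulr1 (le_trans _ h)// mulr_sumr ler_sum// => i _.
by rewrite invfM mulrA mulrA mulfV ?lt0r_neq0// mul1r mulrC.
Qed.

Let measurable_gaussian_sum :
  measurable_fun setT (fun t : measurableTypeR R => gaussian_sum w x t).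
Proof.
under eq_fun do rewrite gaussian_sumE.
apply: measurable_sum => i; apply: measurable_funM => //.
exact: measurable_normal_pdf_mean.
Qed.

(** Integrating the i-th density under [mu] returns [p i], which the weight cancels, so each of the
    n + 1 terms contributes 1 / (n + 1). *)
Let integral_gaussian_sum : (\int[mu]_t (gaussian_sum w x t)%:E = 1)%E.
Proof.
have n0 : n.+1%:R != 0 :> R by rewrite pnatr_eq0.
under eq_integral => t _ do rewrite gaussian_sumE -sumEFin.
rewrite integral_sum//; last first.
  move=> i; under eq_fun do rewrite EFinM.
  by apply: integrableZl => //; exact: integrable_normal_pdf_mean.
under eq_bigr => i _.
  under eq_integral => t _ do rewrite EFinM.
  rewrite integralZl//; last exact: integrable_normal_pdf_mean.
  rewrite -mixture_densityE -EFinM -/(p i) invfM -mulrA mulVf ?lt0r_neq0// mulr1.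
  over.
by rewrite sumEFin sumr_const card_ord -(mulr_natr n.+1%:R^-1) mulVf.
Qed.

Let gaussian_sum_ae1 : mu.-negligible (~` [set t | gaussian_sum w x t = 1]).
Proof.
have mf : measurable_fun setT
    (fun t : measurableTypeR R => (1 - gaussian_sum w x t)%:E).
  by apply/measurable_EFinP; exact: measurable_funB.
have intg : mu.-integrable setT
    (EFin \o (fun t : measurableTypeR R => gaussian_sum w x t)).
  apply/integrableP; split; first by apply/measurable_EFinP.
  rewrite (_ : (\int[mu]_t _)%E = 1%E) ?ltry//.
  rewrite -integral_gaussian_sum; apply: eq_integral => t _.
  by rewrite /= ger0_norm// sumr_ge0// => i _; rewrite mulr_ge0 ?expR_ge0// ltW.
have int1 : mu.-integrable setT (EFin \o (fun _ : measurableTypeR R => 1)).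
  exact: finite_measure_integrable_cst.
have : (\int[mu]_t `|(1 - gaussian_sum w x t)%:E| = 0)%E.
  under eq_integral => t _.
    rewrite gee0_abs ?lee_fin ?subr_ge0// EFinB.
    over.
  rewrite integralB_EFin// integral_gaussian_sum integral_cst// mul1e.
  apply: (etrans (congr1 (fun z => (z - 1)%E) (probability_setT mu))).
  by rewrite subee.
move=> /(ae_eq_integral_abs mu measurableT mf); apply: negligibleS => t /= t1 h.
by apply: t1; have [] := h I; lra.
Qed.

(** The level set D = 1 carries [mu] and, since D <= 1, consists of maximizers, which
    [gaussian_sum_argmax_card] counts. *)
Lemma npmle_supp_card :
  (supp_card mu <=
     (Num.max 1 (100 * (sample_max x - sample_min x) ^+ 2))%:E)%E.
Proof.
apply: supp_card_le gaussian_sum_ae1 _ => s us s1.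
exact: (gaussian_sum_argmax_card w0 us gaussian_sum_le1).
Qed.

End npmle_support.

(** * Chernoff tails of the mixing law, the noise and their convolution *)

Section tails.
Context {R : realType}.
Implicit Types (mix : probability (measurableTypeR R) R) (u e s sigma : R).

Lemma markov_bound d (T : measurableType d) (nu : probability T R)
    (A : set T) (f : T -> R) (c : R) :
  measurable A -> measurable_fun setT f -> 0 <= c -> (forall t, 0 <= f t) ->
  (forall t, A t -> c <= f t) ->
  (c%:E * nu A <= \int[nu]_t (f t)%:E)%E.
Proof.
move=> mA mf c0 f0 cf.
have mfE : measurable_fun setT (EFin \o f) by exact/measurable_EFinP.
have f0E t : (0 <= (f t)%:E)%E by rewrite lee_fin.
rewrite -(integral_cst nu mA); apply: (@le_trans _ _ (\int[nu]_(t in A) (f t)%:E)%E).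
  by apply: ge0_le_integral => //; exact: measurable_funS mfE.
exact: ge0_subset_integral.
Qed.

Lemma measurable_gt d (T : measurableType d) (f : T -> R) (a : R) :
  measurable_fun setT f -> measurable [set t | a < f t].
Proof.
move=> mf; rewrite -[X in measurable X]setCK; apply: measurableC.
rewrite -[X in measurable X]setTI (_ : ~` _ = [set t | f t <= a]).
  exact: measurable_fun_le.
by apply/seteqP; split => t /=; rewrite leNgt => /negP.
Qed.

(* [e] is 1 or -1: the right or the left tail. *)
Definition half_line u e : set (measurableTypeR R) := [set t | u <= e * t].

Lemma measurable_half_line u e : measurable (half_line u e).
Proof.
rewrite -[half_line u e]setTI; exact: measurable_fun_le.
Qed.

(** Chernoff's bound with t = e u / sigma, optimal for the proxy [sigma]. A positive [sigma] above
    [s] keeps the division meaningful for every real [s]. *)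
Lemma subgaussian_half_line s sigma u e mix :
  subgaussian s mix -> s <= sigma -> 0 < sigma -> 0 <= u -> e ^+ 2 = 1 ->
  (mix (half_line u e) <= (expR (- (u ^+ 2 / (2 * sigma))))%:E)%E.
Proof.
move=> sub ss sg0 u0 e2; set A := half_line u e.
have mE : measurable_fun setT
    (fun t : measurableTypeR R => expR (e * u / sigma * t)).
  by apply: measurableT_comp => //; exact: measurable_funM.
have := @markov_bound _ _ mix A (fun t => expR (e * u / sigma * t))
  (expR (u ^+ 2 / sigma)) (measurable_half_line u e) mE (expR_ge0 _)
  (fun t => expR_ge0 _).
have Ac t : A t -> expR (u ^+ 2 / sigma) <= expR (e * u / sigma * t).
  rewrite /A /half_line /= => ut; rewrite ler_expR.
  rewrite (mulrAC _ _ t) ler_pM2r ?invr_gt0// mulrAC mulrC expr2.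
  by rewrite ler_wpM2l.
move=> /(_ Ac) h; move: (le_trans h (sub (e * u / sigma))) => {h}.
have mA : mix A \is a fin_num.
  by apply: fin_num_measure; exact: measurable_half_line.
rewrite -(fineK mA) -EFinM !lee_fin => h.
rewrite -(ler_pM2l (expR_gt0 (u ^+ 2 / sigma))) (le_trans h)// -expRD ler_expR.
have -> : (e * u / sigma) ^+ 2 = (u / sigma) ^+ 2.
  by rewrite -mulrA exprMn e2 mul1r.
have -> : u ^+ 2 / sigma - u ^+ 2 / (2 * sigma) = sigma * (u * sigma^-1) ^+ 2 / 2.
  by field; lra.
by rewrite ler_pM2r ?invr_gt0// ler_wpM2r// sqr_ge0.
Qed.

(* Exponential tilting by [e * u] shifts the mean of the Gaussian density to
   [e * u], so no integral has to be computed. *)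
Lemma normal_half_line u e : 0 <= u -> e ^+ 2 = 1 ->
  (normal_prob (0 : R) 1 (half_line u e) <= (expR (- (u ^+ 2 / 2)))%:E)%E.
Proof.
move=> u0 e2.
have mH := measurable_half_line u e.
have pdf0 m (z : R) : (0 <= (normal_pdf m 1 z)%:E)%E.
  by rewrite lee_fin normal_pdf_ge0.
have pdf1 (z : R) : (0 <= (expR (- (u ^+ 2 / 2)) * normal_pdf (e * u) 1 z)%:E)%E.
  by rewrite lee_fin mulr_ge0 ?expR_ge0 ?normal_pdf_ge0.
apply: (@le_trans _ _
  (\int[lebesgue_measure]_(z in half_line u e)
     (expR (- (u ^+ 2 / 2)) * normal_pdf (e * u) 1 z)%:E)%E).
  apply: ge0_le_integral => //.
  - by apply/measurable_EFinP/measurable_funTS; exact: measurable_normal_pdf.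
  - apply/measurable_EFinP/measurable_funTS/measurable_funM => //.
    exact: measurable_normal_pdf.
  move=> z; rewrite /half_line /= => uz; rewrite lee_fin !normal_pdf1E mulrCA.
  rewrite ler_pM2l ?normal_peak_gt0 ?oner_neq0// -expRD ler_expR.
  have : 0 <= u * (e * z - u) by rewrite mulr_ge0 ?subr_ge0.
  have : (z - e * u) ^+ 2 = z ^+ 2 - 2 * (u * (e * z)) + e ^+ 2 * u ^+ 2 by ring.
  by rewrite e2 subr0 => -> ?; lra.
under eq_integral => z _ do rewrite EFinM.
rewrite ge0_integralZl ?lee_fin ?expR_ge0//; last first.
  by apply/measurable_EFinP/measurable_funTS; exact: measurable_normal_pdf.
rewrite -[leRHS]mule1 lee_wpmul2l ?lee_fin ?expR_ge0//.
exact: (probability_le1 (normal_prob (e * u) 1)).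
Qed.

(** If |theta + z| > 2u, one of theta, -theta, z, -z is at least u: four half-lines. Since sigma >=
    1, the Gaussian tail exp(-u^2 / 2) is also at most [q]. *)
Lemma conv_normal_tail s sigma u mix :
  subgaussian s mix -> s <= sigma -> 1 <= sigma -> 0 <= u ->
  (conv_normal mix [set y | 2 * u < `|y|]%R <=
    (4 * expR (- (u ^+ 2 / (2 * sigma))))%:E)%E.
Proof.
move=> sub ss s1 u0.
have sg0 : 0 < sigma by lra.
set q := expR (- (u ^+ 2 / (2 * sigma))).
have mixq e : e ^+ 2 = 1 -> (mix (half_line u e) <= q%:E)%E.
  by move=> e2; exact: subgaussian_half_line.
have normq e : e ^+ 2 = 1 -> (normal_prob (0 : R) 1 (half_line u e) <= q%:E)%E.
  move=> e2; rewrite (le_trans (normal_half_line u0 e2))// lee_fin ler_expR.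
  rewrite lerN2 ler_wpM2l ?sqr_ge0// lef_pV2 ?posrE; lra.
have e1 : (1 : R) ^+ 2 = 1 by rewrite expr1n.
have eN1 : (- 1 : R) ^+ 2 = 1 by rewrite sqrrN expr1n.
have mH := measurable_half_line u.
rewrite /conv_normal /pushforward.
set nu := (mix \x normal_prob 0 1)%E.
pose N : probability (measurableTypeR R) R := normal_prob (0 : R) 1.
pose Hl e := half_line u e `*` [set: measurableTypeR R].
pose Hr e := [set: measurableTypeR R] `*` half_line u e.
have mHl e : measurable (Hl e) by apply: measurableX => //; exact: mH.
have mHr e : measurable (Hr e) by apply: measurableX => //; exact: mH.
have nul e : e ^+ 2 = 1 -> (nu (Hl e) <= q%:E)%E.
  move=> e2; rewrite /nu (product_measure1E mix N (mH e) measurableT).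
  apply: (le_trans _ (mixq e e2)); rewrite -[leRHS]mule1.
  by rewrite (congr1 (mule _) (probability_setT N)).
have nur e : e ^+ 2 = 1 -> (nu (Hr e) <= q%:E)%E.
  move=> e2; rewrite /nu (product_measure1E mix N measurableT (mH e)).
  apply: (le_trans _ (normq e e2)); rewrite -[leRHS]mul1e.
  by rewrite (congr1 (mule^~ _) (probability_setT mix)).
have mU e : measurable (Hl e `|` Hr e) by exact: measurableU.
apply: (@le_trans _ _ (nu ((Hl 1 `|` Hr 1) `|` (Hl (-1) `|` Hr (-1))))).
  apply: le_measure; rewrite ?inE.
  - apply: measurable_gt.
    apply: measurableT_comp => //; apply: measurable_funD.
      exact: measurable_fst.
    exact: measurable_snd.
  - exact: measurableU.
  move=> [t z] /=; rewrite /Hl /Hr /half_line /= !mul1r !mulN1r.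
  rewrite lter_normr => /orP tz; apply: contrapT.
  move=> /not_orP[/not_orP[h1 h2] /not_orP[h3 h4]].
  have [t1 z1] : t < u /\ z < u.
    by split; rewrite ltNge; apply/negP => ?; [apply: h1|apply: h2].
  have [t2 z2] : - t < u /\ - z < u.
    by split; rewrite ltNge; apply/negP => ?; [apply: h3|apply: h4].
  by case: tz; lra.
apply: (le_trans (measureU2 _ (mU 1) (mU (-1)))).
have -> : (4 * q)%:E = ((q + q)%:E + (q + q)%:E)%E.
  by rewrite -EFinD; congr EFin; lra.
have muU e : e ^+ 2 = 1 -> (nu (Hl e `|` Hr e) <= (q + q)%:E)%E.
  move=> e2; apply: (le_trans (measureU2 _ (mHl e) (mHr e))).
  rewrite EFinD; apply: leeD; [exact: nul|exact: nur].
by apply: leeD; exact: muU.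
Qed.

End tails.

(** * The range of the sample with high probability *)

Section sample_range.
Context {R : realType}.

Lemma iid_conv_normal_bounded (s sigma u : R)
    (mix : probability (measurableTypeR R) R) (n : nat) d (T : measurableType d)
    (P : probability T R) (X : 'I_n.+1 -> {RV P >-> R}) :
  subgaussian s mix -> s <= sigma -> 1 <= sigma -> 0 <= u ->
  iid_from X (conv_normal mix) ->
  exists2 E : set T,
    measurable E /\
    ((1 - n.+1%:R * (4 * expR (- (u ^+ 2 / (2 * sigma)))))%:E <= P E)%E &
    forall omega, E omega -> forall i, `|X i omega| <= 2 * u.
Proof.
move=> sub ss s1 u0 [_ lawX].
pose B : set R := [set y | 2 * u < `|y|].
have mB : measurable B.
  by apply: measurable_gt; exact: normr_measurable.
(* Indexing by [nat] through [inord] fits Boole's inequality, stated for sequences; [inord_val]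
   recovers the index. *)
pose F (k : nat) : set T := X (inord k) @^-1` B.
have mF k : measurable (F k).
  by rewrite -[F k]setTI; exact: (measurable_funPT (X (inord k))).
set q := 4 * _.
have Fq k : (P (F k) <= q%:E)%E.
  have := lawX (inord k) B mB; rewrite /distribution /pushforward => ->.
  exact: conv_normal_tail sub ss s1 u0.
pose U := \big[setU/set0]_(k < n.+1) F k.
have mU : measurable U by exact: bigsetU_measurable.
exists (~` U).
  split; first exact: measurableC.
  rewrite probability_setC// EFinB leeB//.
  apply: (le_trans (Boole_inequality P (fun k _ => mF k))).
  apply: (@le_trans _ _ (\sum_(k < n.+1) q%:E)%E).
    by apply: lee_sum => k _; exact: Fq.
  by rewrite sumEFin sumr_const card_ord mulr_natl.
move=> omega nU i; rewrite leNgt; apply/negP => Bi; apply: nU.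
by apply: (bigsetU_sup (ltn_ord i)); rewrite /F /= inord_val.
Qed.

Lemma sample_range_le n (x : 'I_n.+1 -> R) (a : R) :
  (forall i, `|x i| <= a) -> 0 <= sample_max x - sample_min x <= 2 * a.
Proof.
move=> xa; have xa' i : - a <= x i <= a by rewrite -ler_norml.
have le_max : sample_max x <= a.
  by apply: bigmax_le => [|i _]; [case/andP: (xa' ord0)|case/andP: (xa' i)].
have le_min : - a <= sample_min x.
  by apply: le_bigmin => [|i _]; [case/andP: (xa' ord0)|case/andP: (xa' i)].
have := sample_min_le x ord0; have := sample_max_ge x ord0.
by move=> ? ?; apply/andP; split; lra.
Qed.

End sample_range.

Theorem theorem1 (R : realType) :
  (exists C0 : R,
     forall (n : nat) (x : 'I_n.+1 -> R)
            (mu : probability (measurableTypeR R) R),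
       is_npmle x mu ->
       (supp_card mu <=
          (Num.max 1 (C0 * (sample_max x - sample_min x) ^+ 2))%:E)%E)
  /\
  (forall s tau : R, 0 < tau ->
     exists C : R,
       forall (mix : probability (measurableTypeR R) R), subgaussian s mix ->
       forall (n : nat) (d : measure_display) (T : measurableType d)
              (P : probability T R) (X : 'I_n.+1 -> {RV P >-> R}),
         iid_from X (conv_normal mix) ->
         exists2 E : set T,
           measurable E /\ ((1 - n.+1%:R `^ (- tau))%:E <= P E)%E &
           forall omega : T, E omega ->
           forall mu : probability (measurableTypeR R) R,
             is_npmle (fun i => X i omega) mu ->
             (supp_card mu <= (C * ln n.+1%:R)%:E)%E).
Proof.
split; first by exists 100 => n x mu; exact: npmle_supp_card.
(* The maximum with 1 lets one [sigma] serve both the mixing law and the unit-variance noise. *)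
move=> s tau tau0; pose sigma := Num.max s 1.
have ss : s <= sigma by rewrite le_max lexx.
have s1 : 1 <= sigma by rewrite le_max lexx orbT.
(* The range is at most 4u, and 100 * 16 u^2 = 3200 sigma (tau + 3) ln N for the u chosen below; 1 /
   ln 2 pays for the constant 1 when N >= 2. *)
exists (1 / ln 2 + 3200 * sigma * (tau + 3)) => mix sub [|n] d T P X iid.
  (* For one observation ln 1 = 0, but the required probability is 1 - 1 = 0 and the empty event
     suffices. *)
  exists set0 => //; split => //.
  by rewrite measure0 lee_fin powR1 subrr.
set N : R := n.+2%:R.
have N2 : 2 <= N by rewrite ler_nat.
have ln2 : 0 < ln (2 : R) by rewrite ln_gt0// ltr1n.
have lnN : ln 2 <= ln N by rewrite ler_ln ?posrE; lra.
have K0 : 0 <= 2 * sigma * (tau + 3) * ln N by rewrite !mulr_ge0; lra.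
(* The failure bound 4 N exp(-u^2 / (2 sigma)) becomes 4 N^(-tau - 2), at most N^(-tau) because N >=
   2. *)
pose u := Num.sqrt (2 * sigma * (tau + 3) * ln N).
have u2 : u ^+ 2 = 2 * sigma * (tau + 3) * ln N by exact: sqr_sqrtr.
have [E [mE PE] EX] := iid_conv_normal_bounded sub ss s1 (sqrtr_ge0 _ : 0 <= u) iid.
exists E; first split => //.
  apply: le_trans PE; rewrite lee_fin lerD2l lerN2 -/N u2.
  have -> : 2 * sigma * (tau + 3) * ln N / (2 * sigma) = tau * ln N + 3%:R * ln N.
    by field; lra.
  have N0 : 0 < N by lra.
  have e3 : expR (- (3%:R * ln N)) = N^-1 ^+ 3.
    by rewrite -mulrN expRM_natl expRN lnK ?posrE.
  rewrite /powR gt_eqF// mulNr opprD expRD e3 [expR _ * _]mulrC !mulrA.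
  rewrite ler_piMl ?expR_ge0//.
  have -> : N * 4 / N / N / N = 4 / N ^+ 2 by field; lra.
  by rewrite ler_pdivrMr ?exprn_gt0// mul1r; nra.
move=> omega /EX Xu mu npmle; apply: (le_trans (npmle_supp_card npmle)).
have /andP[L0 Lu] := sample_range_le Xu.
have lnN1 : 1 <= 1 / ln 2 * ln N by rewrite mulrAC mul1r ler_pdivlMr// mul1r.
have L2 : (sample_max (X^~ omega) - sample_min (X^~ omega)) ^+ 2 <= 16 * u ^+ 2.
  have -> : 16 * u ^+ 2 = (2 * (2 * u)) ^+ 2 by ring.
  by rewrite lerXn2r// nnegrE; lra.
rewrite u2 in L2; rewrite lee_fin ge_max mulrDl.
by apply/andP; split; lra.
Qed.
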